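(* Let $n$ be a nonnegative integer and let $p(q)=a_0+qa_1+q^2a_2+\dots+q^na_n\not\equiv 0$ be a polynomial of degree $n$ (so $a_n\neq 0$) in an octonionic variable $q\in\mathbb{O}$, with octonionic coefficients $a_0,\dots,a_n\in\mathbb{O}$. Suppose that for some nonzero real number $\beta$ (regarded as the octonion $\beta e_0$) and some real $\alpha$ with $0\leq\alpha\leq\pi/2$, $$\measuredangle(a_k,\beta)\leq\alpha\leq\pi/2,\qquad k=0,1,2,\dots,n,$$ and that $$|a_0|\leq|a_1|\leq\dots\leq|a_{n-1}|\leq|a_n|.$$ Then all the zeros of $p$ in $\mathbb{O}$ lie in $$|q|\leq\cos\alpha+\sin\alpha+\frac{2\sin\alpha}{|a_n|}\sum_{k=0}^{n-1}|a_k|.$$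
   Context: $\mathbb{O}$ denotes the (nonassociative, alternative) real division algebra of octonions, with real basis $e_0=1,e_1,\dots,e_7$ and multiplication $e_\alpha e_\beta=-\delta_{\alpha\beta}+\sum_{\gamma=1}^7\psi_{\alpha\beta\gamma}e_\gamma$ for $\alpha,\beta\in\{1,\dots,7\}$, where $\psi$ is totally antisymmetric, equals $1$ on the triples $(1,2,3),(1,4,5),(2,4,6),(3,4,7),(2,5,7),(1,7,6),(5,3,6)$, and vanishes on triples not obtained by permuting one of these. Every octonion is $\omega=\sum_{k=0}^7x_ke_k$ with $x_k\in\mathbb{R}$, and $|\omega|=\left(\sum_{k=0}^7x_k^2\right)^{1/2}$. Powers $q^k$ are unambiguous since $\mathbb{O}$ is power-associative, and $q^ka_k$ means the product of the octonion $q^k$ with the octonion $a_k$ on its right. A zero of $p$ is a $q\in\mathbb{O}$ with $p(q)=0$. For nonzero $q_1=\sum_{\ell=0}^7x_\ell e_\ell$ and $q_2=\sum_{\ell=0}^7y_\ell e_\ell$ in $\mathbb{O}$, regarded as vectors in $\mathbb{R}^8$, the angle $\measuredangle(q_1,q_2)\in[0,\pi]$ is defined by $$\cos\measuredangle(q_1,q_2)=\frac{\sum_{\ell=0}^7x_\ell y_\ell}{|q_1||q_2|}.$$ The condition $\measuredangle(a_k,\beta)\leq\alpha$ is regarded as satisfied when $a_k=0$. *)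

(* Defs.v *)
From HB Require Import structures.
From mathcomp Require Import all_boot all_order all_algebra.
From mathcomp Require Import all_classical all_reals all_analysis.

Set Implicit Arguments.
Unset Strict Implicit.
Unset Printing Implicit Defensive.

Import Order.TTheory GRing.Theory Num.Theory.

Local Open Scope ring_scope.

(* The row [x] stands for x_0 e_0 + ... + x_7 e_7.  The library norm [`|x|] on
   row vectors is the maximum norm; the octonion norm is [onorm] below. *)
Notation octonion R := 'rV[R]_8.

Definition psi_triples : seq (nat * nat * nat) :=
  [:: (1, 2, 3); (1, 4, 5); (2, 4, 6); (3, 4, 7);
      (2, 5, 7); (1, 7, 6); (5, 3, 6)]%N.

(* Total antisymmetry: the even permutations of three indices are the cyclic
   shifts, and the odd ones are the cyclic shifts after a swap. *)
Definition psi_even (a b c : nat) : bool :=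
  [|| (a, b, c) \in psi_triples, (b, c, a) \in psi_triples
    | (c, a, b) \in psi_triples].

Definition psi (a b c : nat) : int :=
  if psi_even a b c then 1 else if psi_even b a c then -1 else 0.

(* The coefficient of e_c in e_a e_b. *)
Definition omul_coef (a b c : nat) : int :=
  if a == 0%N then (b == c)%:R
  else if b == 0%N then (a == c)%:R
  else if c == 0%N then - (a == b)%:R
  else psi a b c.

Section Octonion.
Variable R : realType.
Implicit Types (x y q : octonion R) (r : R).

Definition oreal r : octonion R := r *: delta_mx 0 0.

Definition omul x y : octonion R :=
  \row_(c < 8) \sum_(a < 8) \sum_(b < 8) (omul_coef a b c)%:~R * (x 0 a * y 0 b).

Definition oexp q (k : nat) : octonion R := iter k (omul q) (oreal 1).

Definition odot x y : R := \sum_i x 0 i * y 0 i.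

Definition onorm x : R := Num.sqrt (\sum_i x 0 i ^+ 2).

(* Only meaningful for nonzero [x] and [y]. *)
Definition oangle x y : R := acos (odot x y / (onorm x * onorm y)).

(* The coefficients are [a 0], ..., [a n]; later values of [a] are unused. *)
Definition opoly_eval (n : nat) (a : nat -> octonion R) q : octonion R :=
  \sum_(k < n.+1) omul (oexp q k) (a k).

End Octonion.

(* Main.v *)
Require Import Defs.
From HB Require Import structures.
From mathcomp Require Import all_boot all_order all_algebra.
From mathcomp Require Import all_classical all_reals all_analysis.
From mathcomp Require Import ring lra.

(* Left multiplication by [q] scales the norm by [|q|] and satisfies
   [q (q x) = 2 Re(q) (q x) - |q|^2 x], so [q^k x] is the [k]-fold left
   multiplication of [x] by [q].  Hence [p q = 0] gives, on subtracting [q (p q)],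
     [q^(n+1) a_n = a_0 + \sum_(k < n) q^(k+1) (a_(k+1) - a_k)].
   If [|q| > 1], dividing norms by [|q|^n] bounds [|q| |a_n|] by
   [|a_0| + \sum_(k < n) |a_(k+1) - a_k|]; the cone condition controls each
   difference (Govil--Rahman), the sum telescopes, and [1 <= cos + sin] on
   [[0, pi/2]] absorbs [|a_0|].  The same inequality settles [|q| <= 1]. *)

Set Implicit Arguments.
Unset Strict Implicit.
Unset Printing Implicit Defensive.

Import Order.TTheory GRing.Theory Num.Theory.

Local Open Scope ring_scope.

Section Octonion.
Variable R : realType.
Implicit Types (q x y u v : octonion R) (r s : R).

(** * Octonion multiplication in coordinates *)

Lemma sum_ord8 (F : 'I_8 -> R) :
  \sum_i F i = F (inord 0) + F (inord 1) + F (inord 2) + F (inord 3)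
    + F (inord 4) + F (inord 5) + F (inord 6) + F (inord 7).
Proof.
rewrite (eq_bigr (fun i : 'I_8 => F (inord (nat_of_ord i)))).
  by rewrite !big_ord_recr big_ord0 /= add0r.
by move=> i _; rewrite inord_val.
Qed.

Lemma ord8_ind (P : 'I_8 -> Prop) :
  P (inord 0) -> P (inord 1) -> P (inord 2) -> P (inord 3) ->
  P (inord 4) -> P (inord 5) -> P (inord 6) -> P (inord 7) -> forall i, P i.
Proof.
move=> P0 P1 P2 P3 P4 P5 P6 P7 i; rewrite -(inord_val i).
by case: i => -[|[|[|[|[|[|[|[|]]]]]]]].
Qed.

Ltac eval_omul_coef :=
  repeat match goal with |- context [omul_coef ?a ?b ?c] =>
    let v := eval vm_compute in (omul_coef a b c) in
    match v with
    | Posz 0 => change (omul_coef a b c) with (0 : int)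
    | Posz 1 => change (omul_coef a b c) with (1 : int)
    | Negz 0 => change (omul_coef a b c) with (-1 : int)
    end
  end.

(** Expanding the multiplication table once lets the norm and alternativity identities be settled
    coordinatewise by [ring]. *)
Lemma omul_coord q x (c : nat) : (c < 8)%N ->
  let q_ i := q 0 (inord i) in let x_ i := x 0 (inord i) in
  omul q x 0 (inord c) = nth 0 [::
      q_ 0 * x_ 0 - q_ 1 * x_ 1 - q_ 2 * x_ 2 - q_ 3 * x_ 3 -
        q_ 4 * x_ 4 - q_ 5 * x_ 5 - q_ 6 * x_ 6 - q_ 7 * x_ 7;
      q_ 0 * x_ 1 + q_ 1 * x_ 0 + q_ 2 * x_ 3 - q_ 3 * x_ 2 +
        q_ 4 * x_ 5 - q_ 5 * x_ 4 - q_ 6 * x_ 7 + q_ 7 * x_ 6;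
      q_ 0 * x_ 2 - q_ 1 * x_ 3 + q_ 2 * x_ 0 + q_ 3 * x_ 1 +
        q_ 4 * x_ 6 + q_ 5 * x_ 7 - q_ 6 * x_ 4 - q_ 7 * x_ 5;
      q_ 0 * x_ 3 + q_ 1 * x_ 2 - q_ 2 * x_ 1 + q_ 3 * x_ 0 +
        q_ 4 * x_ 7 - q_ 5 * x_ 6 + q_ 6 * x_ 5 - q_ 7 * x_ 4;
      q_ 0 * x_ 4 - q_ 1 * x_ 5 - q_ 2 * x_ 6 - q_ 3 * x_ 7 +
        q_ 4 * x_ 0 + q_ 5 * x_ 1 + q_ 6 * x_ 2 + q_ 7 * x_ 3;
      q_ 0 * x_ 5 + q_ 1 * x_ 4 - q_ 2 * x_ 7 + q_ 3 * x_ 6 -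
        q_ 4 * x_ 1 + q_ 5 * x_ 0 - q_ 6 * x_ 3 + q_ 7 * x_ 2;
      q_ 0 * x_ 6 + q_ 1 * x_ 7 + q_ 2 * x_ 4 - q_ 3 * x_ 5 -
        q_ 4 * x_ 2 + q_ 5 * x_ 3 + q_ 6 * x_ 0 - q_ 7 * x_ 1;
      q_ 0 * x_ 7 - q_ 1 * x_ 6 + q_ 2 * x_ 5 + q_ 3 * x_ 4 -
        q_ 4 * x_ 3 - q_ 5 * x_ 2 + q_ 6 * x_ 1 + q_ 7 * x_ 0
    ] c.
Proof.
move=> c_lt8 q_ x_; rewrite mxE !sum_ord8 !inordK //.
by move: c c_lt8 => [|[|[|[|[|[|[|[|//]]]]]]]] _;
  eval_omul_coef; rewrite !(mulr0z, mulr1z, mulrN1z) /= /q_ /x_; ring.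
Qed.

(** Degen's eight-square identity. *)
Lemma onorm_omul q x : onorm (omul q x) = onorm q * onorm x.
Proof.
rewrite /onorm -sqrtrM; last by apply: sumr_ge0 => i _; exact: sqr_ge0.
by congr Num.sqrt; rewrite !sum_ord8 !omul_coord //=; ring.
Qed.

(** Left alternativity, [q (q x) = (q q) x], combined with [q^2 = 2 Re(q) q - |q|^2]; it stands in
    for associativity. *)
Lemma omul_omul q x : omul q (omul q x) =
  (2 * q 0 (inord 0)) *: omul q x - (\sum_i q 0 i ^+ 2) *: x.
Proof.
(* Naming the inner factor [y] makes [omul_coord] expand only the outer product; the coordinates of
   [y] are substituted afterwards. *)
have := @omul_coord q x; move: (omul q x) => y yE.
apply/rowP; elim/ord8_ind; (rewrite sum_ord8 omul_coord; last by []);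
  rewrite !mxE; move: (y 0) (q 0) (x 0) yE => y_ q_ x_ yE;
  do 8!(rewrite yE; last by []); rewrite /=; ring.
Qed.

Lemma omul_is_linear q : linear (omul q).
Proof.
move=> r x y; apply/rowP => c; rewrite !mxE mulr_sumr -big_split /=.
apply: eq_bigr => a _; rewrite mulr_sumr -big_split /=.
by apply: eq_bigr => b _; rewrite !mxE; ring.
Qed.

HB.instance Definition _ q :=
  GRing.isLinear.Build R _ _ _ (omul q) (omul_is_linear q).

Lemma omulPl r s x y z :
  omul (r *: x + s *: y) z = r *: omul x z + s *: omul y z.
Proof.
apply/rowP => c; rewrite !mxE !mulr_sumr -big_split /=.
apply: eq_bigr => a _; rewrite !mulr_sumr -big_split /=.
by apply: eq_bigr => b _; rewrite !mxE; ring.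
Qed.

Lemma oreal_coord r (i : nat) : (i < 8)%N ->
  oreal r 0 (inord i) = if i is 0%N then r else 0.
Proof.
move=> i_lt8; rewrite !mxE eqxx -val_eqE /= inordK //.
by case: i i_lt8 => [|i] _; rewrite ?mulr1 ?mulr0.
Qed.

Lemma omul1o x : omul (oreal 1) x = x.
Proof.
by apply/rowP; elim/ord8_ind; rewrite omul_coord // !oreal_coord //=; ring.
Qed.

Lemma omulo1 q : omul q (oreal 1) = q.
Proof.
by apply/rowP; elim/ord8_ind; rewrite omul_coord // !oreal_coord //=; ring.
Qed.

(* Left multiplication by [q] satisfies a quadratic equation with real
   coefficients, so its powers stay in the real span of [id] and [omul q]. *)
Lemma iter_omul q k :
  exists r s, forall x, iter k (omul q) x = r *: x + s *: omul q x.
Proof.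
elim: k => [|k [r [s IHk]]].
  by exists 1, 0 => x; rewrite scale1r scale0r addr0.
exists (- (s * \sum_i q 0 i ^+ 2)), (r + s * (2 * q 0 (inord 0))) => x.
rewrite iterS IHk (linearD (omul q)) !(linearZ_LR (omul q)) /= omul_omul.
rewrite scalerBr !scalerA scalerDl.
by rewrite scaleNr addrA [RHS]addrC.
Qed.

(** The scalars [r] and [s] serve all vectors at once: at [1] they give [q^k = r + s q], and right
    multiplication by [x] yields the same combination as iterating on [x]. *)
Lemma omul_oexp q k x : omul (oexp q k) x = iter k (omul q) x.
Proof.
have [r [s iterE]] := iter_omul q k.
by rewrite /oexp !iterE omulPl omul1o omulo1.
Qed.

(** * Euclidean norm and inner product *)

Lemma onorm_ge0 x : 0 <= onorm x. Proof. exact: sqrtr_ge0. Qed.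

Lemma sqr_onorm x : onorm x ^+ 2 = \sum_i x 0 i ^+ 2.
Proof. by rewrite sqr_sqrtr //; apply: sumr_ge0 => i _; exact: sqr_ge0. Qed.

Lemma onorm_gt0 x : x != 0 -> 0 < onorm x.
Proof.
move=> x_neq0; rewrite lt0r onorm_ge0 andbT; apply: contra x_neq0 => /eqP x0.
have /eqP := sqr_onorm x; rewrite x0 expr0n /= eq_sym psumr_eq0; last first.
  by move=> i _; exact: sqr_ge0.
move=> /allP sq0; apply/eqP/rowP => i; rewrite mxE; apply/eqP.
by have := sq0 i (mem_index_enum i); rewrite sqrf_eq0.
Qed.

Lemma onormN x : onorm (- x) = onorm x.
Proof. by congr Num.sqrt; apply: eq_bigr => i _; rewrite mxE sqrrN. Qed.

Lemma onorm0 : onorm (0 : octonion R) = 0.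
Proof. by rewrite /onorm big1 ?sqrtr0 // => i _; rewrite mxE expr0n. Qed.

Lemma onorm_oreal r : onorm (oreal r) = `|r|.
Proof.
rewrite /onorm sum_ord8 !oreal_coord // -sqrtr_sqr; congr Num.sqrt.
by rewrite /=; ring.
Qed.

(** The predicate [P] allows a restriction to the imaginary coordinates in [odot_ge]. *)
Lemma sum_cauchy_schwarz (I : finType) (P : pred I) (f g : I -> R) :
  (\sum_(i | P i) f i * g i) ^+ 2 <=
    (\sum_(i | P i) f i ^+ 2) * (\sum_(i | P i) g i ^+ 2).
Proof.
set D := \sum_(i | P i) f i * g i.
set F := \sum_(i | P i) f i ^+ 2; set G := \sum_(i | P i) g i ^+ 2.
have F_ge0 : 0 <= F by apply: sumr_ge0 => i _; exact: sqr_ge0.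
have : 0 <= \sum_(i | P i) (F * g i - D * f i) ^+ 2.
  by apply: sumr_ge0 => i _; exact: sqr_ge0.
(* The factor [F] cancels when positive; when it is zero, every [f i] with [P i] vanishes, and so
   does [D]. *)
have -> : \sum_(i | P i) (F * g i - D * f i) ^+ 2 = F * (F * G - D ^+ 2).
  have expand r t : \sum_(i | P i) (r * g i - t * f i) ^+ 2 =
      r ^+ 2 * G - 2 * r * t * D + t ^+ 2 * F.
    rewrite !mulr_sumr -sumrB -big_split /=.
    by apply: eq_bigr => i _; ring.
  by rewrite expand; ring.
have [F_gt0|F_le0 _] := ltP 0 F; first by rewrite pmulr_rge0 // subr_ge0.
have F0 : F = 0 by apply: le_anti; rewrite F_le0.
rewrite F0 mul0r /D big1 ?expr0n // => i Pi.
have /eqP := F0; rewrite psumr_eq0 => [/allP /(_ i (mem_index_enum i))|j _].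
  by rewrite Pi sqrf_eq0 => /eqP ->; rewrite mul0r.
exact: sqr_ge0.
Qed.

Lemma sqr_onormD x y :
  onorm (x + y) ^+ 2 = onorm x ^+ 2 + 2 * odot x y + onorm y ^+ 2.
Proof.
rewrite !sqr_onorm /odot mulr_sumr -!big_split.
by apply: eq_bigr => i _; rewrite mxE /=; ring.
Qed.

Lemma odot_le x y : odot x y <= onorm x * onorm y.
Proof.
apply: le_trans (ler_norm _) _; rewrite -ler_sqr ?nnegrE ?mulr_ge0 ?onorm_ge0 //.
by rewrite real_normK ?num_real // exprMn !sqr_onorm sum_cauchy_schwarz.
Qed.

Lemma onormD x y : onorm (x + y) <= onorm x + onorm y.
Proof.
rewrite -ler_sqr ?nnegrE ?addr_ge0 ?onorm_ge0 // sqr_onormD sqrrD.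
by have := odot_le x y; lra.
Qed.

Lemma onorm_sum (n : nat) (f : 'I_n -> octonion R) :
  onorm (\sum_i f i) <= \sum_i onorm (f i).
Proof.
elim/big_ind2: _ => [|x r y s xr ys|//]; first by rewrite onorm0.
by apply: le_trans (onormD _ _) _; exact: lerD.
Qed.

Lemma onorm_iter q k x :
  onorm (iter k (omul q) x) = onorm q ^+ k * onorm x.
Proof.
elim: k => [|k IHk]; first by rewrite mul1r.
by rewrite iterS onorm_omul IHk exprS mulrA.
Qed.

(** * Geometry of the cone *)

(** The real coordinates contribute at least [c^2 |u| |v|]. The imaginary parts have norms at most
    [s |u|] and [s |v|], so by Cauchy-Schwarz they contribute at least [- s^2 |u| |v|]. The factor
    [c^2 - s^2] is [cos (2 alpha)]. *)
Lemma odot_ge (c s : R) u v : 0 <= c -> 0 <= s -> c ^+ 2 + s ^+ 2 = 1 ->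
  c * onorm u <= u 0 0 -> c * onorm v <= v 0 0 ->
  (c ^+ 2 - s ^+ 2) * (onorm u * onorm v) <= odot u v.
Proof.
move=> c_ge0 s_ge0 cs1 cu cv.
have tail w : c * onorm w <= w 0 0 ->
    \sum_(i | i != 0) w 0 i ^+ 2 <= (s * onorm w) ^+ 2.
  move=> cw; have := sqr_onorm w; rewrite (bigD1 0) //= => w2.
  have : (c * onorm w) ^+ 2 <= w 0 0 ^+ 2.
    by rewrite ler_sqr ?nnegrE // ?(le_trans _ cw) ?mulr_ge0 ?onorm_ge0.
  have : (c ^+ 2 + s ^+ 2) * onorm w ^+ 2 = onorm w ^+ 2 by rewrite cs1 mul1r.
  by rewrite !exprMn; lra.
rewrite /odot (bigD1 0) //=; set T := \sum_(i | i != 0) _.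
have T_ge : - (s * onorm u * (s * onorm v)) <= T.
  suff : `|T| <= s * onorm u * (s * onorm v) by rewrite ler_norml => /andP[].
  rewrite -ler_sqr ?nnegrE ?mulr_ge0 ?onorm_ge0 // real_normK ?num_real //.
  apply: le_trans (sum_cauchy_schwarz _ _ _) _; rewrite exprMn.
  by apply: ler_pM; rewrite ?tail //; apply: sumr_ge0 => i _; exact: sqr_ge0.
have uv : c * onorm u * (c * onorm v) <= u 0 0 * v 0 0.
  by apply: ler_pM; rewrite ?mulr_ge0 ?onorm_ge0.
have -> : (c ^+ 2 - s ^+ 2) * (onorm u * onorm v) =
  c * onorm u * (c * onorm v) - s * onorm u * (s * onorm v) by ring.
exact: lerD.
Qed.

(* Govil--Rahman: [u] and [v] lie in a cone of half-angle [alpha] around [1],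
   with [c = cos alpha] and [s = sin alpha], so their angle is at most
   [2 alpha]. *)
Lemma onormB_cone (c s : R) u v : 0 <= c -> 0 <= s -> c ^+ 2 + s ^+ 2 = 1 ->
  c * onorm u <= u 0 0 -> c * onorm v <= v 0 0 -> onorm v <= onorm u ->
  onorm (u - v) <= c * (onorm u - onorm v) + s * (onorm u + onorm v).
Proof.
move=> c_ge0 s_ge0 cs1 cu cv vu.
have uv := odot_ge c_ge0 s_ge0 cs1 cu cv.
have dotN : odot u (- v) = - odot u v.
  by rewrite /odot -sumrN; apply: eq_bigr => i _; rewrite mxE mulrN.
have [U_ge0 V_ge0] := (onorm_ge0 u, onorm_ge0 v).
rewrite -ler_sqr ?nnegrE ?onorm_ge0 ?addr_ge0 ?mulr_ge0 ?subr_ge0 ?addr_ge0 //.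
rewrite sqr_onormD onormN dotN.
move: (onorm u) (onorm v) (odot u v) vu U_ge0 V_ge0 uv => U V d vu U_ge0 V_ge0 uv.
(* The first two terms already dominate [|u - v|^2] by [uv]; the last is nonnegative because
   [V <= U]. *)
have -> : (c * (U - V) + s * (U + V)) ^+ 2 =
    (c ^+ 2 + s ^+ 2) * (U ^+ 2 + V ^+ 2)
    - 2 * ((c ^+ 2 - s ^+ 2) * (U * V)) + 2 * (c * s * ((U - V) * (U + V))).
  by ring.
have : 0 <= c * s * ((U - V) * (U + V)).
  by rewrite mulr_ge0 ?mulr_ge0 ?subr_ge0 ?addr_ge0.
by rewrite cs1; lra.
Qed.

(** Cosine decreases on [[0, pi]], so the angle bound becomes a linear inequality; the sign of
    [beta] covers cones around either real half-axis. *)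
Lemma oangle_oreal_le (beta alpha : R) x : beta != 0 -> x != 0 ->
  0 <= alpha -> alpha <= pi -> oangle x (oreal beta) <= alpha ->
  cos alpha * onorm x <= Num.sg beta * x 0 0.
Proof.
move=> beta_neq0 x_neq0 alpha_ge0 alpha_lepi.
have x_gt0 := onorm_gt0 x_neq0.
have beta_gt0 : 0 < `|beta| by rewrite normr_gt0.
have dotE : odot x (oreal beta) = `|beta| * (Num.sg beta * x 0 0).
  rewrite mulrA [`|_| * _]mulrC -numEsg /odot (bigD1 0) //= big1 => [|i i_neq0].
    by rewrite !mxE eqxx mulr1 addr0 mulrC.
  by rewrite !mxE (negPf i_neq0) !mulr0.
rewrite /oangle onorm_oreal dotE [onorm x * _]mulrC -mulf_div divff ?gt_eqF //.
rewrite mul1r; set t := _ / onorm x => le_alpha.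
have t_itv : -1 <= t <= 1.
  rewrite -ler_norml normrM normfV (gtr0_norm x_gt0) ler_pdivrMr // mul1r.
  rewrite normrM normr_sg beta_neq0 mul1r -ler_sqr ?nnegrE ?onorm_ge0 //.
  rewrite real_normK ?num_real // sqr_onorm (bigD1 0) //= lerDl.
  by apply: sumr_ge0 => i _; exact: sqr_ge0.
rewrite -ler_pdivlMr // -/t -[t](@acosK R) ?in_itv //.
by rewrite leNgt ltr_cos -?leNgt // in_itv /= ?acos_ge0 ?acos_lepi ?alpha_ge0.
Qed.

Lemma opoly_telescope (n : nat) (a : nat -> octonion R) q :
  opoly_eval n a q = 0 ->
  iter n.+1 (omul q) (a n) =
    a 0%N + \sum_(k < n) iter k.+1 (omul q) (a k.+1 - a k).
Proof.
rewrite /opoly_eval; under eq_bigr do rewrite omul_oexp.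
move=> p0; have := congr1 (omul q) p0; rewrite linear0 linear_sum /=.
(* Splitting off the top term of [q (p q)] and the constant term of [p q] leaves two sums over
   [k < n] with equal powers [k.+1]. *)
rewrite big_ord_recr /= => qp0; rewrite big_ord_recl in p0.
have iterB k x y :
    iter k (omul q) (x - y) = iter k (omul q) x - iter k (omul q) y.
  by elim: k => //= k ->; rewrite linearB.
rewrite (eq_bigr (fun k : 'I_n => iter k.+1 (omul q) (a k.+1) -
  iter k.+1 (omul q) (a k))) => [|k _]; last exact: (iterB k.+1).
rewrite sumrB addrA [X in X - _]p0 sub0r; apply/eqP.
by rewrite -addr_eq0 addrC qp0.
Qed.

End Octonion.

Theorem theorem3p5 (R : realType) (n : nat) (a : nat -> octonion R)
  (beta alpha : R)
  (a_n_neq0 : a n != 0)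
  (beta_neq0 : beta != 0)
  (alpha_ge0 : 0 <= alpha) (alpha_le : alpha <= pi / 2)
  (angle_le : forall k : nat, (k <= n)%N -> a k != 0 ->
    oangle (a k) (oreal beta) <= alpha)
  (norm_nondecr : forall k : nat, (k < n)%N -> onorm (a k) <= onorm (a k.+1)) :
  forall q : octonion R, opoly_eval n a q = 0 ->
    onorm q <= cos alpha + sin alpha
      + 2 * sin alpha / onorm (a n) * \sum_(k < n) onorm (a k).
Proof.
move=> q p0.
have an_gt0 := onorm_gt0 a_n_neq0.
have pi_gt0 := pi_gt0 R.
have alpha_lepi : alpha <= pi by lra.
have cone k : (k <= n)%N -> cos alpha * onorm (a k) <= Num.sg beta * a k 0 0.
  (* A zero coefficient satisfies the linear form trivially. *)
  move=> le_kn; have [->|ak_neq0] := eqVneq (a k) 0.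
    by rewrite onorm0 mxE !mulr0.
  exact: oangle_oreal_le (angle_le k le_kn ak_neq0).
have c_ge0 : 0 <= cos alpha by apply: cos_ge0_pihalf; apply/andP; split; lra.
have s_ge0 : 0 <= sin alpha by apply: sin_ge0_pi; rewrite alpha_ge0.
have := cos2Dsin2 alpha.
move: (cos alpha) (sin alpha) c_ge0 s_ge0 cone => c s c_ge0 s_ge0 cone cs1.
have cs_ge1 : 1 <= c + s.
  rewrite -ler_sqr ?nnegrE ?addr_ge0 // sqrrD expr1n.
  by have := mulr_ge0 c_ge0 s_ge0; lra.
set S := \sum_(k < n) _.
have S_ge0 : 0 <= S by apply: sumr_ge0 => i _; exact: onorm_ge0.
have bound_ge1 : 1 <= c + s + 2 * s / onorm (a n) * S.
  by rewrite (le_trans cs_ge1) // lerDl !mulr_ge0 ?invr_ge0 ?onorm_ge0.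
have [/le_trans->//|q_gt1] := leP (onorm q) 1.
(* The cone bound regrouped by [c (U - V) + s (U + V) = (c + s) (U - V) + 2 s V], whose first term
   telescopes. Scaling by the sign of [beta] is an isometry that moves the cone to the one around
   [1]. *)
have diff k : (k < n)%N -> onorm (a k.+1 - a k) <=
    (c + s) * (onorm (a k.+1) - onorm (a k)) + 2 * s * onorm (a k).
  move=> lt_kn; have sg2 : Num.sg beta * Num.sg beta = 1.
    by rewrite -expr2 sqr_sg beta_neq0.
  have onorm_sg x : onorm (Num.sg beta *: x) = onorm x.
    rewrite /onorm; congr Num.sqrt; apply: eq_bigr => i _.
    by rewrite mxE exprMn expr2 sg2 mul1r.
  have := @onormB_cone R c s (Num.sg beta *: a k.+1) (Num.sg beta *: a k).
  rewrite -scalerBr !onorm_sg !mxE.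
  move/(_ c_ge0 s_ge0 cs1 (cone _ lt_kn) (cone _ (ltnW lt_kn))).
  by move/(_ (norm_nondecr k lt_kn)); lra.
have tele : \sum_(k < n) onorm (a k.+1 - a k) <=
    (c + s) * (onorm (a n) - onorm (a 0%N)) + 2 * s * S.
  rewrite -(@telescope_sumr _ 0 n (fun k => onorm (a k))) // big_mkord.
  rewrite !mulr_sumr -big_split; apply: ler_sum => k _; exact: diff.
have : onorm q ^+ n.+1 * onorm (a n) <=
    onorm q ^+ n * (onorm (a 0%N) + \sum_(k < n) onorm (a k.+1 - a k)).
  rewrite -onorm_iter (opoly_telescope p0) (le_trans (onormD _ _)) // mulrDr.
  (* Since [|q| > 1], both [1] and [|q|^(k+1)] for [k < n] are at most [|q|^n]. *)
  apply: lerD; first by rewrite ler_peMl ?onorm_ge0 ?exprn_ege1 // ltW.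
  apply: le_trans (onorm_sum _) _; rewrite mulr_sumr; apply: ler_sum => k _.
  by rewrite onorm_iter ler_wpM2r ?onorm_ge0 // ler_weXn2l ?ltn_ord // ltW.
have q_gt0 : 0 < onorm q by lra.
rewrite exprSr -mulrA ler_pM2l ?exprn_gt0 // => main.
rewrite -(ler_pM2r an_gt0) mulrDl [_ * S * _]mulrAC divfK ?gt_eqF //.
(* This is the slack left after [|a_0|] meets the [- (c + s) |a_0|] of the telescoped sum. *)
have : 0 <= onorm (a 0%N) * (c + s - 1).
  by rewrite mulr_ge0 ?onorm_ge0 // subr_ge0.
by lra.
Qed.
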